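(* The dual adjunction between frames and spaces restricts to an adjunction \[ \Omega:\mathbf{Top}_D\leftrightarrows \mathbf{Frm}_{\mathcal{E}}^{op}:\mathsf{pt}_D,\qquad \Omega\dashv\mathsf{pt}_D, \] between the category of $T_D$ spaces and the (opposite of the) category of frames with exact maps, and this restricts to the known $T_D$ duality, i.e. the dual equivalence between $T_D$ spaces and $D$-spatial frames.
   Context: A space $X$ is $T_D$ if for every $x\in X$ there are opens $U,V$ with $U\setminus V=\{x\}$; $\mathbf{Top}_D$ is the category of $T_D$ spaces and continuous maps. $\Omega$ sends a space to its frame of opens and a continuous map $f$ to $f^{-1}$. A prime $p$ of a frame $L$ ($p\neq 1$, $x\wedge y\le p$ implies $x\le p$ or $y\le p$) is covered if $\bigwedge_i x_i=p$ implies $x_i=p$ for some $i$. $\mathsf{pt}_D(L)$ is the set of covered primes of $L$, with open sets $\{p:a\not\le p\}$ for $a\in L$ (the subspace topology from the prime spectrum); it is always a $T_D$ space. On a frame map $f:L\to M$ for which $f_*$ sends covered primes to covered primes (a D-morphism), where $f_*$ is the right adjoint of $f$, $\mathsf{pt}_D(f)$ is the restriction of $f_*$. $\mathbf{Frm}_D$ is the category of frames and D-morphisms. A frame is $D$-spatial if each of its elements is the meet of the covered primes above it. The known $T_D$ duality is the dual equivalence, given by $\Omega$ and $\mathsf{pt}_D$, between $\mathbf{Top}_D$ and the full subcategory of $\mathbf{Frm}_D$ on the $D$-spatial frames. A meet $\bigwedge_i x_i$ in $L$ is exact if $(\bigwedge_i x_i)\vee a=\bigwedge_i(x_i\vee a)$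 for all $a\in L$. A frame map $f:L\to M$ is exact if for every exact meet $\bigwedge_i x_i$ in $L$, the meet $\bigwedge_i f(x_i)$ is exact and equals $f(\bigwedge_i x_i)$. $\mathbf{Frm}_{\mathcal{E}}$ is the category of frames and exact maps. *)

(* Defs.v *)
From HB Require Import structures.
From mathcomp Require Import all_boot all_order.
From mathcomp Require Import boolp classical_sets functions topology.

Set Implicit Arguments.
Unset Strict Implicit.
Unset Printing Implicit Defensive.

Import Order.TTheory.
Local Open Scope classical_set_scope.
Local Open Scope order_scope.

(** * Categories, functors, adjunctions *)

Record category := Category {
  ob :> Type;
  hom : ob -> ob -> Type;
  idc : forall X, hom X X;
  compc : forall X Y Z, hom Y Z -> hom X Y -> hom X Z;
  comp1l : forall X Y (f : hom X Y), compc (idc Y) f = f;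
  comp1r : forall X Y (f : hom X Y), compc f (idc X) = f;
  compcA : forall W X Y Z (h : hom Y Z) (g : hom X Y) (f : hom W X),
    compc h (compc g f) = compc (compc h g) f }.

Arguments hom {c} _ _.
Arguments idc {c} _.
Arguments compc {c X Y Z} _ _.

Definition is_iso (C : category) (X Y : C) (f : hom X Y) : Prop :=
  exists g : hom Y X, compc g f = idc X /\ compc f g = idc Y.

Definition opcat (C : category) : category.
Proof.
refine (@Category C (fun X Y => @hom C Y X) (fun X => idc X)
  (fun X Y Z g f => @compc C Z Y X f g) _ _ _).
- by move=> X Y f; exact: comp1r.
- by move=> X Y f; exact: comp1l.
- by move=> X Y Z T h g f; rewrite compcA.
Defined.

Definition full_subcat (C : category) (P : C -> Prop) : category.
Proof.
refine (@Category {X : C | P X} (fun X Y => @hom C (sval X) (sval Y))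
  (fun X => idc (sval X)) (fun X Y Z g f => compc g f) _ _ _).
- by move=> X Y f; exact: comp1l.
- by move=> X Y f; exact: comp1r.
- by move=> X Y Z T h g f; exact: compcA.
Defined.

Section WideSubcategory.
Variables (C : category) (W : forall X Y : C, hom X Y -> Prop).
Hypothesis W1 : forall X, W (idc X).
Hypothesis Wcomp : forall X Y Z (g : hom Y Z) (f : hom X Y),
  W g -> W f -> W (compc g f).

Let whom (X Y : C) := {f : hom X Y | W f}.

Lemma whomP (X Y : C) (f g : whom X Y) : sval f = sval g -> f = g.
Proof. exact: eq_sig_hprop (fun=> @Prop_irrelevance _) _ _. Qed.

Definition wide_subcat : category.
Proof.
refine (@Category C whom (fun X => exist _ (idc X) (W1 X))
  (fun X Y Z g f => exist _ (compc (sval g) (sval f))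
                            (Wcomp (svalP g) (svalP f))) _ _ _).
- by move=> X Y f; apply: whomP; rewrite /= comp1l.
- by move=> X Y f; apply: whomP; rewrite /= comp1r.
- by move=> X Y Z T h g f; apply: whomP; rewrite /= compcA.
Defined.

End WideSubcategory.

Record functor (C D : category) := Functor {
  fob :> C -> D;
  fhom : forall X Y : C, hom X Y -> hom (fob X) (fob Y);
  fhom1 : forall X, fhom (idc X) = idc (fob X);
  fhomM : forall X Y Z (g : hom Y Z) (f : hom X Y),
    fhom (compc g f) = compc (fhom g) (fhom f) }.

Arguments fhom {C D} _ {X Y} _.

(* [adjunction F G] : F is left adjoint to G. *)
Record adjunction (C D : category) (F : functor C D) (G : functor D C) :=
  Adjunction {
  adj_unit : forall X : C, hom X (G (F X));
  adj_counit : forall Y : D, hom (F (G Y)) Y;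
  unit_nat : forall (X X' : C) (f : hom X X'),
    compc (adj_unit X') f = compc (fhom G (fhom F f)) (adj_unit X);
  counit_nat : forall (Y Y' : D) (g : hom Y Y'),
    compc g (adj_counit Y) = compc (adj_counit Y') (fhom F (fhom G g));
  triangle_l : forall X : C,
    compc (adj_counit (F X)) (fhom F (adj_unit X)) = idc (F X);
  triangle_r : forall Y : D,
    compc (fhom G (adj_counit Y)) (adj_unit (G Y)) = idc (G Y) }.

Arguments adj_unit {C D F G} _ _.
Arguments adj_counit {C D F G} _ _.

Definition adjoint_equivalence (C D : category) (F : functor C D)
    (G : functor D C) (A : adjunction F G) : Prop :=
  (forall X : C, is_iso (adj_unit A X)) /\ (forall Y : D, is_iso (adj_counit A Y)).

(** * Frames *)

(* The display is a phantom parameter of MathComp orders, hence fixing one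
   for all frames loses no generality. *)
Fact frame_display : Order.disp_t. Proof. exact: Order.Disp tt tt. Qed.

HB.mixin Record TBLattice_isFrame T of Order.TBLattice frame_display T := {
  fjoin : set T -> T;
  fjoin_isLub : forall A : set T, isLub A (fjoin A);
  meet_fjoin : forall (x : T) (A : set T),
    Order.meet x (fjoin A) = fjoin [set Order.meet x a | a in A] }.

#[short(type="frameType")]
HB.structure Definition Frame :=
  {T of TBLattice_isFrame T & Order.TBLattice frame_display T}.

(* The meet of A is the join of its lower bounds. *)
Definition fmeet (L : frameType) (A : set L) : L := fjoin (lbound A).

Section FrameTheory.
Variable L : frameType.
Implicit Types (A B : set L) (x y a b p : L).

Lemma fjoin_ub A x : A x -> x <= fjoin A.
Proof. by move=> Ax; apply: (fjoin_isLub A).1. Qed.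

Lemma fjoin_le A b : (fjoin A <= b) <-> (forall a, A a -> a <= b).
Proof.
split=> [Ab a Aa|]; first exact: le_trans (fjoin_ub Aa) Ab.
exact: (fjoin_isLub A).2.
Qed.

Lemma fmeet_lb A x : A x -> fmeet A <= x.
Proof. by move=> Ax; apply/fjoin_le => a; apply. Qed.

Lemma le_fmeet A b : (b <= fmeet A) <-> (forall a, A a -> b <= a).
Proof.
split=> [Ab a Aa|Ab]; first exact: le_trans Ab (fmeet_lb Aa).
exact: fjoin_ub.
Qed.

End FrameTheory.

Definition frame_map (L M : frameType) (f : L -> M) : Prop :=
  [/\ f \top = \top,
      {morph f : x y / Order.meet x y} &
      forall A : set L, f (fjoin A) = fjoin (f @` A)].

Record frameHom (L M : frameType) := FrameHom {
  frameHom_fun :> L -> M;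
  frameHomP : frame_map frameHom_fun }.

Lemma frameHomE (L M : frameType) (f g : frameHom L M) : f =1 g -> f = g.
Proof.
case: f g => [f fP] [g gP] /= /funext fg.
by case: _ / fg in gP *; congr FrameHom; apply: Prop_irrelevance.
Qed.

Lemma frame_map_id (L : frameType) : frame_map (@idfun L).
Proof. by split=> // A; rewrite image_id. Qed.

Lemma frame_map_comp (L M N : frameType) (g : frameHom M N)
  (f : frameHom L M) : frame_map (g \o f).
Proof.
case: f g => [f [f1 fI fU]] [g [g1 gI gU]]; split=> /=.
- by rewrite f1.
- by move=> x y /=; rewrite fI gI.
- by move=> A; rewrite fU gU image_comp.
Qed.

Definition Frm : category.
Proof.
refine (@Category frameType frameHom (fun L => FrameHom (@frame_map_id L))
  (fun L M N g f => FrameHom (frame_map_comp g f)) _ _ _);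
by move=> *; apply: frameHomE.
Defined.

Definition right_adjoint (L M : frameType) (f : L -> M) (b : M) : L :=
  fjoin [set a | f a <= b].

Lemma frameHom_le (L M : frameType) (f : frameHom L M) (a b : L) :
  a <= b -> f a <= f b.
Proof.
case: f => f [_ fI _] /= /meet_idPl ab; apply/meet_idPl.
by rewrite -fI ab.
Qed.

Lemma right_adjointP (L M : frameType) (f : frameHom L M) a b :
  (a <= right_adjoint f b) <-> (f a <= b).
Proof.
split=> [ab|]; last exact: fjoin_ub.
apply: le_trans (frameHom_le f ab) _.
have [_ _ ->] := frameHomP f.
by apply/fjoin_le => _ [x /= xb <-].
Qed.

Lemma frame_le_anti (L : frameType) (x y : L) :
  (forall a, a <= x <-> a <= y) -> x = y.
Proof.
by move=> xy; apply/le_anti/andP; split; [apply/(xy x)|apply/(xy y)].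
Qed.

Lemma right_adjoint_id (L : frameType) : right_adjoint (@idfun L) =1 id.
Proof.
move=> b; apply: frame_le_anti => a.
exact: (right_adjointP (FrameHom (@frame_map_id L))).
Qed.

Lemma right_adjoint_comp (L M N : frameType) (g : frameHom M N)
  (f : frameHom L M) b :
  right_adjoint (g \o f) b = right_adjoint f (right_adjoint g b).
Proof.
apply: frame_le_anti => a.
have H1 := right_adjointP (FrameHom (frame_map_comp g f)) a b.
have H2 := right_adjointP f a (right_adjoint g b).
have H3 := right_adjointP g (f a) b.
by split=> [/H1/H3/H2|/H2/H3/H1].
Qed.

(** * Primes, exactness *)

Definition prime_elt (L : frameType) (p : L) : Prop :=
  p <> \top /\
  forall x y : L, Order.meet x y <= p -> x <= p \/ y <= p.

(* Here and below, a family (x_i) enters only through the set A of its members: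
   meets do not depend on repetitions. *)
Definition covered (L : frameType) (p : L) : Prop :=
  forall A : set L, fmeet A = p -> A p.

Definition covered_prime (L : frameType) (p : L) : Prop :=
  prime_elt p /\ covered p.

Definition D_spatial (L : frameType) : Prop :=
  forall a : L, a = fmeet [set p : L | covered_prime p /\ a <= p].

Definition D_morphism (L M : frameType) (f : frameHom L M) : Prop :=
  forall p : M, covered_prime p -> covered_prime (right_adjoint f p).

Definition exact_meet (L : frameType) (A : set L) : Prop :=
  forall a : L, Order.join (fmeet A) a = fmeet [set Order.join x a | x in A].

Definition exact_map (L M : frameType) (f : frameHom L M) : Prop :=
  forall A : set L, exact_meet A ->
    exact_meet (f @` A) /\ fmeet (f @` A) = f (fmeet A).

Lemma exact_map_id (L : Frm) : exact_map (idc L).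
Proof. by move=> A eA; rewrite /= image_id. Qed.

Lemma exact_map_comp (L M N : Frm) (g : hom M N) (f : hom L M) :
  exact_map g -> exact_map f -> exact_map (compc g f).
Proof.
move=> gE fE A /fE[/gE[gA gm] fm] /=.
by rewrite -image_comp; split=> //; rewrite gm fm.
Qed.

Lemma D_morphism_id (L : Frm) : D_morphism (idc L).
Proof. by move=> p pP; rewrite /= right_adjoint_id. Qed.

Lemma D_morphism_comp (L M N : Frm) (g : hom M N) (f : hom L M) :
  D_morphism g -> D_morphism f -> D_morphism (compc g f).
Proof. by move=> gD fD p /gD/fD; rewrite /= right_adjoint_comp. Qed.

Definition FrmE : category := wide_subcat exact_map_id exact_map_comp.
Definition FrmD : category := wide_subcat D_morphism_id D_morphism_comp.
Definition FrmDSp : category := @full_subcat FrmD D_spatial.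

(** * Spaces *)

Definition Top : category.
Proof.
refine (@Category topologicalType (fun X Y => continuousType X Y)
  (fun X => idfun) (fun X Y Z g f => (g \o f : continuousType X Z)) _ _ _);
by move=> *; apply/continuousEP.
Defined.

Definition T_D (X : topologicalType) : Prop :=
  forall x : X, exists U V : set X, [/\ open U, open V & U `\` V = [set x]].

Definition TopD : category := @full_subcat Top T_D.

(** ** The frame of opens *)

Definition opens (X : topologicalType) : Type := set_type (@open X).

HB.instance Definition _ (X : topologicalType) := Choice.on (opens X).

Section Opens.
Variable X : topologicalType.
Implicit Types (U V W : opens X) (A : set (opens X)).

Definition Opens (U : set X) (oU : open U) : opens X :=
  exist _ U (mem_set oU).

Lemma opensP U : open (val U). Proof. exact: set_mem (valP U). Qed.

Definition opens_le U V : bool := `[< val U `<=` val V >].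

Lemma opens_le_refl : reflexive opens_le.
Proof. by move=> U; apply/asboolP. Qed.

Lemma opens_le_anti : antisymmetric opens_le.
Proof.
move=> U V /andP[/asboolP UV /asboolP VU].
by apply: val_inj; apply/seteqP.
Qed.

Lemma opens_le_trans : transitive opens_le.
Proof.
by move=> V U W /asboolP UV /asboolP VW; apply/asboolP; apply: subset_trans VW.
Qed.

HB.instance Definition _ := Order.Le_isPOrder.Build frame_display (opens X)
  opens_le_refl opens_le_anti opens_le_trans.

Lemma opens_leP U V : (U <= V) <-> (val U `<=` val V).
Proof. by split=> /asboolP. Qed.

Definition opens_meet U V : opens X := Opens (openI (opensP U) (opensP V)).
Definition opens_join U V : opens X := Opens (openU (opensP U) (opensP V)).

Lemma opens_meetP U V W :
  (U <= opens_meet V W) = (U <= V) && (U <= W).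
Proof.
apply/idP/andP => [/opens_leP UVW|[/opens_leP UV /opens_leP UW]].
  by split; apply/opens_leP => x /UVW[].
by apply/opens_leP => x Ux; split; [apply: UV|apply: UW].
Qed.

Lemma opens_joinP U V W :
  (opens_join U V <= W) = (U <= W) && (V <= W).
Proof.
apply/idP/andP => [/opens_leP UVW|[/opens_leP UW /opens_leP VW]].
  by split; apply/opens_leP => x Ux; apply: UVW; [left|right].
by apply/opens_leP => x [/UW|/VW].
Qed.

HB.instance Definition _ :=
  Order.POrder_MeetJoin_isLattice.Build frame_display (opens X)
    opens_meetP opens_joinP.

Lemma opens_le0 U : Opens open0 <= U.
Proof. by apply/opens_leP. Qed.

Lemma opens_le1 U : U <= Opens openT.
Proof. by apply/opens_leP. Qed.

HB.instance Definition _ :=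
  Order.hasBottom.Build frame_display (opens X) opens_le0.
HB.instance Definition _ :=
  Order.hasTop.Build frame_display (opens X) opens_le1.

Definition opens_fjoin A : opens X :=
  Opens (@bigcup_open X _ A (fun U => val U) (fun U _ => opensP U)).

Lemma opens_fjoin_isLub A : isLub A (opens_fjoin A).
Proof.
split=> [U AU|W ubW]; apply/opens_leP; first by move=> x Ux; exists U.
by move=> x [U AU]; move: x; apply/opens_leP/ubW.
Qed.

Lemma opens_meet_fjoin U A :
  Order.meet U (opens_fjoin A) = opens_fjoin [set Order.meet U V | V in A].
Proof.
apply: val_inj; apply/seteqP; split=> x /=.
  by move=> [Ux [V AV Vx]]; exists (Order.meet U V) => //; exists V.
by move=> [_ [V AV <-] [Ux Vx]]; split=> //; exists V.
Qed.

HB.instance Definition _ := TBLattice_isFrame.Build (opens X)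
  opens_fjoin_isLub opens_meet_fjoin.

End Opens.

Section OmegaMap.
Variables (X Y : topologicalType) (f : continuousType X Y).

Lemma open_preimage (U : opens Y) : open (f @^-1` val U).
Proof. exact: (continuousP f).1 cts_fun _ (opensP U). Qed.

Definition preimage_opens (U : opens Y) : opens X := Opens (open_preimage U).

Lemma preimage_opens_frame_map : frame_map preimage_opens.
Proof.
split=> [|U V|A]; apply: val_inj => //=.
apply/seteqP; split=> x /=.
  by move=> [U AU Ux]; exists (preimage_opens U) => //; exists U.
by move=> [_ [U AU <-] Ux]; exists U.
Qed.

Definition Omega_map : frameHom (opens Y) (opens X) :=
  FrameHom preimage_opens_frame_map.

End OmegaMap.

Definition Omega : functor Top (opcat Frm).
Proof.
refine (@Functor Top (opcat Frm) (fun X => opens X)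
  (fun X Y f => Omega_map f) _ _);
by move=> *; apply: frameHomE => U; apply: val_inj.
Defined.

(** ** The prime spectrum *)

Definition pt (L : frameType) : Type := set_type [set p : L | prime_elt p].

HB.instance Definition _ (L : frameType) := Choice.on (pt L).

Section Spectrum.
Variable L : frameType.

Lemma ptP (p : pt L) : prime_elt (val p). Proof. exact: set_mem (valP p). Qed.

Definition pt_open : set (set (pt L)) :=
  range (fun a : L => [set p : pt L | ~ (a <= val p)]).

Lemma pt_openT : pt_open setT.
Proof.
exists \top => //; apply/seteqP; split=> p //= _.
by rewrite le1x => /eqP; apply: (ptP p).1.
Qed.

Lemma pt_openI : setI_closed pt_open.
Proof.
move=> _ _ [a _ <-] [b _ <-]; exists (Order.meet a b) => //.
apply/seteqP; split=> p /=.
  by move=> abp; split=> h; apply: abp; [apply: leIxl|apply: leIxr].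
by move=> [ap bp] /(ptP p).2 [].
Qed.

Lemma pt_open_bigU (I : Type) (F : I -> set (pt L)) :
  (forall i, pt_open (F i)) -> pt_open (\bigcup_i F i).
Proof.
move=> oF.
exists (fjoin [set a : L | exists i, F i = [set p : pt L | ~ (a <= val p)]]) => //.
apply/seteqP; split=> p /=.
  move=> np; apply: contrapT => nF; apply: np; apply/fjoin_le => a [i Fi].
  by apply: contrapT => ap; apply: nF; exists i => //; rewrite Fi.
move=> [i _ Fip] /fjoin_le np; have [a _ Fi] := oF i.
by move: Fip; rewrite -Fi /=; apply; apply: np; exists i.
Qed.

HB.instance Definition _ :=
  isOpenTopological.Build (pt L) pt_openT pt_openI pt_open_bigU.

Lemma pt_openE : @open (pt L) = pt_open.
Proof. by []. Qed.

(* Subspace topology : the instance of the library on [set_type]. *)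
Definition ptD : topologicalType := set_type [set p : pt L | covered (val p)].

Lemma ptDP (p : ptD) : covered_prime (val (val p)).
Proof. by split; [exact: ptP|exact: set_mem (valP p)]. Qed.

Definition ptD_incl : continuousType ptD (pt L) :=
  mkcts (@initial_continuous ptD (pt L) set_val).

Lemma ptD_T_D : T_D ptD.
Proof.
move=> p.
pose q := val (val p); pose r := fmeet [set x : L | q < x].
have nrq : ~ (r <= q).
  move=> rq; have : q = r.
    by apply/le_anti/andP; split=> //; apply/le_fmeet => x /ltW.
  by move=> /esym/((ptDP p).2 _) /=; rewrite ltxx.
have oD (a : L) : open [set s : ptD | ~ (a <= val (val s))].
  by exists [set s : pt L | ~ (a <= val s)] => //; rewrite pt_openE; exists a.
exists [set s : ptD | ~ (r <= val (val s))],
       [set s : ptD | ~ (q <= val (val s))]; split=> //.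
apply/seteqP; split=> [s /= [nrs /contrapT qs]|s /= ->]; last first.
  by split=> //; apply; exact: lexx.
apply/val_inj/val_inj/eqP; rewrite eq_sym; apply/negPn/negP => sq.
by apply/nrs/fmeet_lb => /=; rewrite lt_neqAle sq.
Qed.

End Spectrum.

Section PtMap.
Variables (L M : frameType) (f : frameHom L M).

Lemma right_adjoint_prime (p : M) :
  prime_elt p -> prime_elt (right_adjoint f p).
Proof.
have [f1 fI _] := frameHomP f.
move=> [p1 pI]; split=> [e|x y].
  apply: p1; apply/eqP; rewrite -le1x -f1; apply/right_adjointP.
  by rewrite e.
move/right_adjointP; rewrite fI => /pI[]/right_adjointP; by [left|right].
Qed.

Definition pt_fun (p : pt M) : pt L :=
  exist _ (right_adjoint f (val p)) (mem_set (right_adjoint_prime (ptP p))).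

Lemma pt_fun_continuous : continuous pt_fun.
Proof.
apply/continuousP => _ [a _ <-]; rewrite pt_openE; exists (f a) => //.
by apply/seteqP; split=> p /= np /right_adjointP.
Qed.

Definition pt_map : continuousType (pt M) (pt L) := mkcts pt_fun_continuous.

Hypothesis fD : D_morphism f.

Definition ptD_fun (p : ptD M) : ptD L :=
  exist _ (pt_fun (val p)) (mem_set (fD (ptDP p)).2).

Lemma ptD_fun_continuous : continuous ptD_fun.
Proof.
apply/continuousP => _ [B oB <-].
exists (pt_fun @^-1` B) => //.
exact: (continuousP pt_fun).1 pt_fun_continuous _ oB.
Qed.

Definition ptD_map : continuousType (ptD M) (ptD L) :=
  mkcts ptD_fun_continuous.

End PtMap.

Definition pt_functor : functor (opcat Frm) Top.
Proof.
refine (@Functor (opcat Frm) Top (fun L => pt L)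
  (fun M L f => pt_map f) _ _).
- move=> L; apply/continuousEP => p; apply: val_inj.
  exact: (@right_adjoint_id L).
- move=> N M L g f; apply/continuousEP => p; apply: val_inj.
  exact: right_adjoint_comp.
Defined.

Definition ptD_ob (L : frameType) : TopD := exist T_D (ptD L) (@ptD_T_D L).

Definition ptD_functor : functor (opcat FrmD) TopD.
Proof.
refine (@Functor (opcat FrmD) TopD ptD_ob
  (fun M L f => ptD_map (svalP f)) _ _).
- move=> L; apply/continuousEP => p; apply/val_inj/val_inj.
  exact: (@right_adjoint_id _ (val (val p))).
- move=> N M L g f; apply/continuousEP => p; apply/val_inj/val_inj.
  exact: right_adjoint_comp.
Defined.

(** ** The dual adjunction between frames and spaces *)

Section DualAdjunction.
Variable X : topologicalType.

(* The complement of the closure of x is the largest open missing x. *)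
Definition point_compl (x : X) : opens X :=
  Opens (closed_openC (@closed_closure X [set x])).

Lemma le_point_compl (x : X) (U : opens X) :
  (U <= point_compl x) <-> ~ (val U) x.
Proof.
split=> [/opens_leP Ux xU|nUx].
  by apply: (Ux _ xU); apply: subset_closure.
apply/opens_leP => y Uy /(_ (val U)) h.
have [|z [/= -> //]] := h.
by apply: open_nbhs_nbhs; split=> //; exact: opensP.
Qed.

Lemma point_compl_prime (x : X) : prime_elt (point_compl x).
Proof.
split=> [e|U V].
  have : (\top : opens X) <= point_compl x by rewrite e.
  by move/le_point_compl; apply.
move=> /le_point_compl UVx; have [Ux|nUx] := pselect (val U x).
  by right; apply/le_point_compl => Vx; apply: UVx.
by left; apply/le_point_compl.
Qed.

Definition dual_unit_fun (x : X) : pt (opens X) :=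
  exist _ (point_compl x) (mem_set (point_compl_prime x)).

Lemma dual_unit_continuous : continuous dual_unit_fun.
Proof.
apply/continuousP => _ [U _ <-].
rewrite (_ : _ @^-1` _ = val U); first exact: opensP.
apply/seteqP; split=> x /=; last by move=> Ux /le_point_compl.
by move=> h; apply: contrapT => /le_point_compl.
Qed.

Definition dual_unit : continuousType X (pt (opens X)) :=
  mkcts dual_unit_continuous.

Variable L : frameType.

Definition spec_open (a : L) : opens (pt L) :=
  @Opens (pt L) [set p : pt L | ~ (a <= val p)] (ex_intro2 _ _ a I erefl).

Lemma spec_open_frame_map : frame_map spec_open.
Proof.
split=> [|x y|A]; apply: val_inj; apply/seteqP; split=> p //=.
- by move=> _; rewrite le1x => /eqP; apply: (ptP p).1.
- by move=> np; split=> h; apply: np; [apply: leIxl|apply: leIxr].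
- by move=> [xp yp] /(ptP p).2[].
- move=> np; apply: contrapT => nA; apply: np; apply/fjoin_le => a Aa.
  by apply: contrapT => ap; apply: nA; exists (spec_open a) => //; exists a.
- by move=> [_ [a Aa <-] ap] /fjoin_le /(_ _ Aa).
Qed.

Definition dual_counit : frameHom L (opens (pt L)) :=
  FrameHom spec_open_frame_map.

End DualAdjunction.

Definition dual_adjunction : adjunction Omega pt_functor.
Proof.
refine (@Adjunction Top (opcat Frm) Omega pt_functor
  (fun X => dual_unit X) (fun L => dual_counit L) _ _ _ _).
- move=> X Y f; apply/continuousEP => x; apply/val_inj => /=.
  apply: frame_le_anti => U.
  have H1 := le_point_compl (f x) U.
  have H2 := right_adjointP (Omega_map f) U (point_compl x).
  have H3 := le_point_compl x (Omega_map f U).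
  by split=> [/H1/H3/H2|/H2/H3/H1].
- move=> M L f; apply: frameHomE => a; apply/val_inj => /=.
  by apply/seteqP; split=> p /= np /right_adjointP.
- move=> X; apply: frameHomE => U; apply: val_inj => /=.
  apply/seteqP; split=> x /=; last by move=> Ux /le_point_compl.
  by move=> h; apply: contrapT => /le_point_compl.
- move=> L; apply/continuousEP => p; apply: val_inj => /=.
  apply: frame_le_anti => a.
  have H1 := right_adjointP (dual_counit L) a (point_compl p).
  have H2 := le_point_compl p (dual_counit L a).
  split=> [/H1/H2 /= h|ap]; first exact: contrapT.
  by apply/H1/H2 => /=; apply.
Defined.

(** ** Restrictions of Omega and pt_D *)

(* These functors exist only under the preservation properties that they take
   as arguments. *)

Definition OmegaE
    (h : forall (X Y : TopD) (f : hom X Y), exact_map (Omega_map f)) :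
  functor TopD (opcat FrmE).
Proof.
refine (@Functor TopD (opcat FrmE) (fun X => opens (sval X))
  (fun X Y f => exist _ (Omega_map f) (h X Y f)) _ _);
by move=> *; apply: whomP; apply: frameHomE => U; apply: val_inj.
Defined.

Definition ptDE
    (h : forall (L M : Frm) (f : hom L M), exact_map f -> D_morphism f) :
  functor (opcat FrmE) TopD.
Proof.
refine (@Functor (opcat FrmE) TopD ptD_ob
  (fun M L f => ptD_map (h L M (sval f) (svalP f))) _ _).
- move=> L; apply/continuousEP => p; apply/val_inj/val_inj.
  exact: (@right_adjoint_id _ (val (val p))).
- move=> N M L g f; apply/continuousEP => p; apply/val_inj/val_inj.
  exact: right_adjoint_comp.
Defined.

Definition OmegaDSp
    (hD : forall (X Y : TopD) (f : hom X Y), D_morphism (Omega_map f))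
    (hS : forall X : TopD, D_spatial (opens (sval X))) :
  functor TopD (opcat FrmDSp).
Proof.
refine (@Functor TopD (opcat FrmDSp)
  (fun X => exist _ (opens (sval X) : FrmD) (hS X))
  (fun X Y f => exist _ (Omega_map f) (hD X Y f)) _ _);
by move=> *; apply: whomP; apply: frameHomE => U; apply: val_inj.
Defined.

Definition ptDSp : functor (opcat FrmDSp) TopD.
Proof.
refine (@Functor (opcat FrmDSp) TopD (fun L => ptD_ob (sval L))
  (fun M L f => fhom ptD_functor (f : @hom (opcat FrmD) (sval M) (sval L))) _ _).
- move=> L; exact: (fhom1 ptD_functor).
- move=> N M L g f; exact: (fhomM ptD_functor).
Defined.

(* Main.v *)
Require Import Defs.
From mathcomp Require Import all_boot all_order.
From mathcomp Require Import boolp classical_sets functions topology.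

Set Implicit Arguments.
Unset Strict Implicit.
Unset Printing Implicit Defensive.

(** Everything rests on how exact meets see covered elements.  If the meet of
    [A] is exact and lies below a covered [q], then joining with [q] gives
    [q] as the meet of the [a \/ q], so some [a] in [A] is already below [q]:
    for exact meets, a covered element behaves as if it were completely
    prime ([exact_meet_covered]).  Two facts follow.

    - An exact map is a D-morphism ([exact_D_morphism]).  If [q = f_* p] were
      not covered, it would be the meet of the elements strictly above it.
      That meet is automatically exact ([exact_strict_meet]), so [f] preserves
      it, and [exact_meet_covered], applied to [p], puts some [f x] with
      [q < x] below [p], that is, [x <= q].

    - A D-morphism into a D-spatial frame is exact ([D_morphism_exact]), since
      inequalities in a D-spatial frame are tested on covered primes, which
      [f_*] carries back to covered primes, where [exact_meet_covered]
      applies.  So exact maps and D-morphisms agree between D-spatial frames,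
      and every exactness claim reduces to a statement about covered primes.

    On the side of spaces, every open is the meet of the complements of the
    closures of the points outside it.  Hence every covered open is such a
    complement.  In a T_D space these complements are also covered, so that the covered
    primes of its frame of opens are exactly its points, the frame is
    D-spatial, and the unit is a homeomorphism.  The right adjoint of the
    inverse image map sends the complement of the closure of [x] to that of
    [f x], hence inverse image maps are D-morphisms and thereby exact; the
    counit is treated in the same way.  The counit is always onto, as the
    opens of [pt_D L] are by definition the values of the counit, and it is
    one-to-one precisely when covered primes separate the elements of [L].
    The adjunction equations hold pointwise, as for the prime spectrum. *)

Import Order.TTheory.
Local Open Scope classical_set_scope.
Local Open Scope order_scope.

(** * Covered elements and exact meets *)

Section CoveredElements.
Variable L : frameType.
Implicit Types (A : set L) (p q a : L).

(** Join the exact meet with [q]: the resulting meet is [q] itself, and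
    coveredness selects one of its members. *)
Lemma exact_meet_covered A q :
  exact_meet A -> covered q -> fmeet A <= q -> exists2 a, A a & a <= q.
Proof.
move=> eA qc /join_idPr Aq.
have [a Aa aq] := qc _ (etrans (esym (eA q)) Aq).
by exists a => //; apply/join_idPr.
Qed.

(** Any family with meet [q] that misses [q] lies strictly above [q]; thus the
    set of all elements strictly above [q] is the only one to test. *)
Lemma covered_of_strict_meet q :
  ~ (fmeet [set x | q < x] <= q) -> covered q.
Proof.
move=> nq A Aq; apply: contrapT => nAq; apply: nq.
rewrite -[leRHS]Aq; apply/le_fmeet => a Aa; apply: fmeet_lb => /=.
rewrite lt_neqAle -{2}Aq fmeet_lb // andbT.
by apply/eqP => qa; rewrite qa in nAq.
Qed.

(** The hypothesis makes [q] the meet.  Joining with [a <= q] changes nothing,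
    while for any other [a] the join [q \/ a] is itself a member of the
    family, and it is fixed by joining with [a]. *)
Lemma exact_strict_meet q :
  fmeet [set x | q < x] <= q -> exact_meet [set x | q < x].
Proof.
move=> mq a; set m := fmeet _ in mq *.
have qm : m = q.
  by apply/le_anti/andP; split=> //; apply/le_fmeet => x /ltW.
apply/le_anti/andP; split.
  apply/le_fmeet => _ [x qx <-].
  by rewrite leUx leUr andbT lexUl // fmeet_lb.
have [aq|naq] := boolP (a <= q).
  rewrite qm (join_idPl aq) -[leRHS]qm.
  apply/le_fmeet => x qx; apply: fmeet_lb; exists x => //.
  exact/join_idPl/(le_trans aq)/ltW.
apply: fmeet_lb; exists (Order.join q a); last by rewrite -joinA joinxx qm.
by rewrite /= lt_neqAle leUl andbT; apply: contra naq => /eqP ->; exact: leUr.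
Qed.

End CoveredElements.

(** * Exact maps and D-morphisms *)

Lemma exact_D_morphism (L M : frameType) (f : frameHom L M) :
  exact_map f -> D_morphism f.
Proof.
move=> fE p [pp pc]; split; first exact: right_adjoint_prime.
apply: covered_of_strict_meet => mq; set q := right_adjoint f p in mq *.
have [eB fm] := fE _ (exact_strict_meet mq).
have [|_ [x qx <-] fxp] := exact_meet_covered eB pc.
  by rewrite fm; apply/right_adjointP.
by move/right_adjointP: fxp => /(lt_le_trans qx); rewrite ltxx.
Qed.

Lemma D_spatial_le (L : frameType) (a b : L) : D_spatial L ->
  (forall p, covered_prime p -> b <= p -> a <= p) -> a <= b.
Proof.
by move=> sL ab; rewrite (sL b); apply/le_fmeet => p [pP bp]; apply: ab.
Qed.

(** A covered prime above [f (fmeet A)] pulls back along [f_*] to a covered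
    prime above the exact meet of [A], hence lies above some [f a]; by
    D-spatiality of [M] this decides every inequality needed. *)
Lemma D_morphism_exact (L M : frameType) (f : frameHom L M) :
  D_spatial M -> D_morphism f -> exact_map f.
Proof.
move=> sM fD A eA.
have fA p : covered_prime p -> f (fmeet A) <= p -> exists2 a, A a & f a <= p.
  move=> /fD[_ cp] /right_adjointP /(exact_meet_covered eA cp) [a Aa].
  by move=> /right_adjointP; exists a.
have ffm : f (fmeet A) <= fmeet (f @` A).
  by apply/le_fmeet => _ [a Aa <-]; apply/frameHom_le/fmeet_lb.
split; last first.
  apply/le_anti/andP; split=> //; apply: D_spatial_le => // p pP.
  by move=> /(fA p pP)[a Aa]; apply: le_trans; apply: fmeet_lb; exists a.
move=> b; apply/le_anti/andP; split.
  apply/le_fmeet => _ [_ [a Aa <-] <-].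
  by rewrite leUx leUr andbT lexUl // fmeet_lb //; exists a.
apply: D_spatial_le => // p pP; rewrite leUx => /andP[mp bp].
have [a Aa ap] := fA p pP (le_trans ffm mp).
apply: (@le_trans _ _ (Order.join (f a) b)); last by rewrite leUx ap.
by apply: fmeet_lb; exists (f a) => //; exists a.
Qed.

(** * Covered primes in frames of opens *)

Section PointComplements.
Variable X : topologicalType.
Implicit Types (x y : X) (U P : opens X).

Lemma opens_fmeet_point_compl U :
  U = fmeet [set point_compl x | x in ~` val U].
Proof.
apply/le_anti/andP; split.
  by apply/le_fmeet => _ [x nUx <-]; apply/le_point_compl.
apply/opens_leP => x mx; apply: contrapT => nUx.
have /le_point_compl : fmeet [set point_compl x | x in ~` val U] <= point_compl x.
  by apply: fmeet_lb; exists x.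
exact.
Qed.

(** Coveredness applied to the previous decomposition of [P]. *)
Lemma covered_point_compl P : covered P -> exists x, point_compl x = P.
Proof. by move=> /(_ _ (esym (opens_fmeet_point_compl P)))[x _ <-]; exists x. Qed.

Hypothesis XTD : T_D X.

(** The T_D axiom in the form used below: [x] together with the complement of
    its closure contains a neighborhood of [x].  Indeed, if [U \ V = {x}],
    then [V] misses [x] and so lies in that complement. *)
Lemma T_D_nbhs x : exists2 W : opens X, val W x &
  forall y, val W y -> y = x \/ val (point_compl x) y.
Proof.
have [U [V [oU oV UV]]] := XTD x.
have [Ux nVx] : (U `\` V) x by rewrite UV.
exists (Opens oU) => // y Uy.
have [Vy|nVy] := pselect (V y); last by left; rewrite -[_ = _]/([set x] y) -UV.
by right; move: y Vy {Uy}; apply/(opens_leP (Opens oV))/le_point_compl.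
Qed.

Lemma point_compl_inj : injective (@point_compl X).
Proof.
move=> x y xy; have [W Wx Wc] := T_D_nbhs x.
have Wy : val W y.
  by apply: contrapT => /le_point_compl; rewrite -xy => /le_point_compl.
have [//|] := Wc y Wy; rewrite xy => cy.
by have /le_point_compl := lexx (point_compl y).
Qed.

(** An open strictly above [point_compl x] contains [x], hence the whole
    neighborhood [W] of [T_D_nbhs]; the meet of all of them therefore still
    contains [x]. *)
Lemma covered_prime_point_compl x : covered_prime (point_compl x).
Proof.
split; first exact: point_compl_prime.
have [W Wx Wc] := T_D_nbhs x.
apply: covered_of_strict_meet => h.
have /le_point_compl : W <= point_compl x; last exact.
apply: le_trans h; apply/le_fmeet => V /= xV; apply/opens_leP => y /Wc[->|].
  apply: contrapT => /le_point_compl Vx.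
  by have := lt_le_trans xV Vx; rewrite ltxx.
by move: y; apply/opens_leP/ltW.
Qed.

Lemma T_D_D_spatial : D_spatial (opens X).
Proof.
move=> U; apply/le_anti/andP; split; first by apply/le_fmeet => P [].
rewrite [leRHS]opens_fmeet_point_compl; apply/le_fmeet => _ [x nUx <-].
apply: fmeet_lb; split; first exact: covered_prime_point_compl.
exact/le_point_compl.
Qed.

End PointComplements.

(** The right adjoint of inverse image acts on points as [f] itself. *)
Lemma right_adjoint_Omega (X Y : topologicalType) (f : continuousType X Y) x :
  right_adjoint (Omega_map f) (point_compl x) = point_compl (f x).
Proof.
apply: frame_le_anti => U.
split=> [/right_adjointP/le_point_compl|/le_point_compl] h.
  exact/le_point_compl.
exact/right_adjointP/le_point_compl.
Qed.

Lemma Omega_D_morphism (X Y : TopD) (f : hom X Y) : D_morphism (Omega_map f).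
Proof.
move=> _ [_ /covered_point_compl[x <-]]; rewrite right_adjoint_Omega.
exact/covered_prime_point_compl/(svalP Y).
Qed.

Lemma Omega_exact (X Y : TopD) (f : hom X Y) : exact_map (Omega_map f).
Proof.
apply: D_morphism_exact; last exact: Omega_D_morphism.
exact/T_D_D_spatial/(svalP X).
Qed.

(** * The unit *)

Section Unit.
Variables (X : topologicalType) (XTD : T_D X).

Definition ptD_unit_fun (x : X) : ptD (opens X) :=
  exist _ (dual_unit X x) (mem_set (covered_prime_point_compl XTD x).2).

Lemma ptD_unit_continuous : continuous ptD_unit_fun.
Proof.
apply/continuousP => _ [B oB <-].
exact: (continuousP (dual_unit X)).1 cts_fun _ oB.
Qed.

Definition ptD_unit : continuousType X (ptD (opens X)) :=
  mkcts ptD_unit_continuous.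

(** The inverse picks the point whose complement is a given covered prime; it
    is continuous because [U] contains that point exactly when [U] is not
    below the prime. *)
Lemma ptD_unit_homeo : exists g : continuousType (ptD (opens X)) X,
  cancel ptD_unit g /\ cancel g ptD_unit.
Proof.
have /choice[g gP] (P : ptD (opens X)) : exists x, point_compl x = val (val P).
  by apply: covered_point_compl; exact: (ptDP P).2.
have gc : continuous g.
  apply/continuousP => U oU.
  have leP P : (Opens oU <= val (val P)) <-> ~ U (g P).
    by rewrite -gP; exact: le_point_compl.
  exists [set P | ~ (Opens oU <= val P)]; first by exists (Opens oU).
  apply/seteqP; split=> P /=; last by move=> UP /leP.
  by move=> h; apply: contrapT => /leP.
exists (mkcts gc); split=> [x|P]; first exact/(point_compl_inj XTD)/gP.
exact/val_inj/val_inj/gP.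
Qed.

End Unit.

(** * The counit *)

Section Counit.
Variable L : frameType.

Definition ptD_counit : frameHom L (opens (ptD L)) :=
  @compc Frm L (opens (pt L)) (opens (ptD L))
    (Omega_map (ptD_incl L)) (dual_counit L).

Lemma ptD_counit_le (a : L) (p : ptD L) :
  (ptD_counit a <= point_compl p) <-> (a <= val (val p)).
Proof.
split=> [/le_point_compl h|ap]; first exact: contrapT.
by apply/le_point_compl; apply.
Qed.

(** Besides giving a triangle identity, this makes the counit a D-morphism,
    every covered open of [ptD L] being a point complement. *)
Lemma right_adjoint_ptD_counit (p : ptD L) :
  right_adjoint ptD_counit (point_compl p) = val (val p).
Proof.
apply: frame_le_anti => a.
by split=> [/right_adjointP/ptD_counit_le|/ptD_counit_le/right_adjointP].
Qed.

Lemma ptD_counit_exact : exact_map ptD_counit.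
Proof.
apply: D_morphism_exact; first exact/T_D_D_spatial/ptD_T_D.
move=> _ [_ /covered_point_compl[p <-]]; rewrite right_adjoint_ptD_counit.
exact: ptDP.
Qed.

Lemma ptD_counit_surj (U : opens (ptD L)) : exists a, ptD_counit a = U.
Proof.
have [B [a _ aB] BU] := opensP U.
by exists a; apply: val_inj; rewrite /= -BU -aB.
Qed.

(** Two elements have the same image exactly when the same covered primes lie
    above them; this is the case for [a] and the meet of the covered primes
    above [a], which injectivity therefore identifies. *)
Lemma ptD_counit_injP : injective ptD_counit <-> D_spatial L.
Proof.
split=> [inj a|sL a b ab].
  apply: inj; apply: val_inj; apply/seteqP; split=> p /= np h; apply: np.
    by apply: le_trans h; apply/le_fmeet => q [].
  by apply: fmeet_lb; split=> //; exact: ptDP.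
have le (c d : L) : ptD_counit c = ptD_counit d -> c <= d.
  move=> cd; apply: D_spatial_le => // p [pP pc] dp.
  pose q : ptD L := exist _ (exist _ p (mem_set pP) : pt L) (mem_set pc).
  by apply/(ptD_counit_le c q); rewrite cd; apply/(ptD_counit_le d q).
by apply/le_anti; rewrite !le.
Qed.

End Counit.

Lemma frameHom_inverse (L M : frameType) (f : frameHom L M) :
  injective f -> (forall b, exists a, f a = b) ->
  exists g : frameHom M L, cancel f g /\ cancel g f.
Proof.
move=> inj /choice[g gK]; have fK : cancel f g by move=> a; apply: inj.
have [f1 fI fU] := frameHomP f.
suff gP : frame_map g by exists (FrameHom gP).
split=> [|x y|A]; apply: inj; rewrite gK ?f1 ?fI ?gK // fU image_comp.
by congr fjoin; rewrite -[LHS]image_id; apply: eq_imagel => b _ /=; rewrite gK.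
Qed.

(** The inverse is a D-morphism since its right adjoint sends the covered
    prime [p] of [L] to the complement of the closure of the point [p]. *)
Lemma ptD_counit_inverse (L : frameType) : D_spatial L ->
  exists g : frameHom (opens (ptD L)) L,
    [/\ D_morphism g, cancel (ptD_counit L) g & cancel g (ptD_counit L)].
Proof.
move=> sL; have [g [fK gK]] :=
  frameHom_inverse ((ptD_counit_injP L).2 sL) (@ptD_counit_surj L).
exists g; split=> // p pP.
pose q : ptD L := exist _ (exist _ p (mem_set pP.1) : pt L) (mem_set pP.2).
rewrite (_ : right_adjoint g p = point_compl q).
  exact/covered_prime_point_compl/ptD_T_D.
apply: frame_le_anti => U; rewrite -[in X in _ <-> X](gK U).
by split=> [/right_adjointP/(ptD_counit_le _ q)|/(ptD_counit_le _ q)/right_adjointP].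
Qed.

(** * The adjunctions *)

Lemma ptD_unit_nat (X Y : topologicalType) (XTD : T_D X) (YTD : T_D Y)
    (f : continuousType X Y) (fD : D_morphism (Omega_map f)) x :
  ptD_unit YTD (f x) = ptD_map fD (ptD_unit XTD x).
Proof. by apply/val_inj/val_inj; rewrite /= right_adjoint_Omega. Qed.

Lemma ptD_counit_nat (L M : frameType) (f : frameHom L M) (fD : D_morphism f) a :
  ptD_counit M (f a) = Omega_map (ptD_map fD) (ptD_counit L a).
Proof.
by apply/val_inj/seteqP; split=> p /= np /right_adjointP.
Qed.

Lemma ptD_triangle_l (X : topologicalType) (XTD : T_D X) (U : opens X) :
  Omega_map (ptD_unit XTD) (ptD_counit (opens X) U) = U.
Proof.
apply/val_inj/seteqP; split=> x /=; last by move=> Ux /le_point_compl.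
by move=> h; apply: contrapT => /le_point_compl.
Qed.

(** Transparent, so that its unit and counit can be compared by conversion with
    those of the other two adjunctions. *)
Definition T_D_adjunction :
  adjunction (OmegaE Omega_exact) (ptDE exact_D_morphism).
Proof.
refine (@Adjunction TopD (opcat FrmE) (OmegaE Omega_exact)
  (ptDE exact_D_morphism) (fun X => ptD_unit (svalP X))
  (fun L => exist _ (ptD_counit L) (@ptD_counit_exact L)) _ _ _ _).
- by move=> X Y f; apply/continuousEP => x; exact: ptD_unit_nat.
- move=> M L f; apply: whomP; apply: frameHomE => a.
  exact: (ptD_counit_nat (exact_D_morphism (svalP f))).
- by move=> X; apply: whomP; apply: frameHomE => U; exact: ptD_triangle_l.
- by move=> L; apply/continuousEP => p; apply/val_inj/val_inj;
  exact: right_adjoint_ptD_counit.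
Defined.

Lemma T_D_spaces_D_spatial (X : TopD) : D_spatial (opens (sval X)).
Proof. exact/T_D_D_spatial/(svalP X). Qed.

Definition T_D_duality :
  adjunction (OmegaDSp Omega_D_morphism T_D_spaces_D_spatial) ptDSp.
Proof.
refine (@Adjunction TopD (opcat FrmDSp)
  (OmegaDSp Omega_D_morphism T_D_spaces_D_spatial) ptDSp
  (fun X => ptD_unit (svalP X))
  (fun L => exist _ (ptD_counit (sval L))
              (exact_D_morphism (@ptD_counit_exact (sval L)))) _ _ _ _).
- by move=> X Y f; apply/continuousEP => x; exact: ptD_unit_nat.
- move=> M L f; apply: whomP; apply: frameHomE => a.
  exact: (ptD_counit_nat (svalP f)).
- by move=> X; apply: whomP; apply: frameHomE => U; exact: ptD_triangle_l.
- by move=> L; apply/continuousEP => p; apply/val_inj/val_inj;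
  exact: right_adjoint_ptD_counit.
Defined.

Lemma T_D_unit_iso (X : TopD) : is_iso (adj_unit T_D_adjunction X).
Proof.
have [g [fK gK]] := ptD_unit_homeo (svalP X).
by exists g; split; apply/continuousEP.
Qed.

Lemma T_D_counit_isoP (L : FrmE) :
  is_iso (adj_counit T_D_adjunction L) <-> D_spatial L.
Proof.
split=> [[g [_ fK]]|sL].
  apply/ptD_counit_injP/(can_inj (g := sval g)) => a.
  exact: (congr1 (fun h : @hom FrmE L L => sval h a) fK).
have [g [gD fK gK]] := ptD_counit_inverse sL.
exists (exist _ g (D_morphism_exact sL gD)).
by split; apply: whomP; apply: frameHomE.
Qed.

Lemma T_D_duality_equivalence : adjoint_equivalence T_D_duality.
Proof.
split=> [|L]; first exact: T_D_unit_iso.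
have [g [gD fK gK]] := ptD_counit_inverse (svalP L).
by exists (exist _ g gD); split; apply: whomP; apply: frameHomE.
Qed.

(** * The theorem *)

Theorem theorem5p2 :
  (* Omega and pt_D restrict to functors between Top_D and Frm_E^op ... *)
  exists (OmegaE_exact : forall (X Y : TopD) (f : hom X Y),
            exact_map (Omega_map f))
         (exact_D : forall (L M : Frm) (f : hom L M),
            exact_map f -> D_morphism f)
  (* ... which are adjoint, ... *)
         (adj : adjunction (OmegaE OmegaE_exact) (ptDE exact_D)),
  (* ... the adjunction being the restriction of the dual adjunction along the
     subspace inclusions of pt_D L into pt L; ... *)
  [/\ (forall X : TopD,
         @compc Top (sval X) (ptD (opens (sval X))) (pt_functor (opens (sval X)))
           (ptD_incl (opens (sval X))) (adj_unit adj X)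
         = adj_unit dual_adjunction (sval X)),
      (forall L : Frm,
         sval (adj_counit adj L)
         = @compc Frm L (Omega (pt_functor L)) (opens (ptD L))
             (Omega_map (ptD_incl L)) (adj_counit dual_adjunction L))
  (* ... and it restricts to the T_D duality. *)
    & [/\ (forall X : TopD, is_iso (adj_unit adj X)),
          (forall L : FrmE, is_iso (adj_counit adj L) <-> D_spatial L),
          (forall L M : Frm, D_spatial L -> D_spatial M ->
             forall f : hom L M, exact_map f <-> D_morphism f)
        & exists (Omega_D : forall (X Y : TopD) (f : hom X Y),
                    D_morphism (Omega_map f))
                 (Omega_sp : forall X : TopD, D_spatial (opens (sval X)))
                 (duality : adjunction (OmegaDSp Omega_D Omega_sp) ptDSp),
            adjoint_equivalence duality /\
            (forall X : TopD, adj_unit duality X = adj_unit adj X) /\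
            (forall L : FrmDSp,
               sval (adj_counit duality L) = sval (adj_counit adj (sval L)))]].
Proof.
exists Omega_exact, exact_D_morphism, T_D_adjunction; split.
- by move=> X; apply/continuousEP.
- by [].
split.
- exact: T_D_unit_iso.
- exact: T_D_counit_isoP.
- move=> L M _ sM f; split; first exact: exact_D_morphism.
  exact: D_morphism_exact.
exists Omega_D_morphism, T_D_spaces_D_spatial, T_D_duality.
by split; [exact: T_D_duality_equivalence | split].
Qed.
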